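(* Let $(X,\mathcal{B})$ be an uncountable standard Borel space, and let $Aut_0(X,\mathcal{B})=Aut(X,\mathcal{B})/Ctbl(X)$ be endowed with the quotient topology $p_0$ of the weak topology $p$. Then the action of $Aut_0(X,\mathcal{B})$ on itself by conjugation is topologically transitive with respect to $p_0$ (the Rokhlin property). Moreover, for every $S\in Aut_0(X,\mathcal{B})$ that is the class of an aperiodic smooth automorphism, the conjugacy class of $S$ is dense: $$Aut_0(X,\mathcal{B})=\overline{\{T^{-1}ST : T\in Aut_0(X,\mathcal{B})\}}^{\,p_0}.$$
   Context: $Aut(X,\mathcal{B})$ is the group of all Borel automorphisms of $(X,\mathcal{B})$ (bijections $T:X\to X$ with $T,T^{-1}$ Borel). The topology $p$ on $Aut(X,\mathcal{B})$ is defined by the base of neighborhoods $W(T;F_1,\ldots,F_n)=\{S\in Aut(X,\mathcal{B}) : SF_i=TF_i,\ i=1,\ldots,n\}$, where $T\in Aut(X,\mathcal{B})$, $n\in\mathbb{N}$ and $F_1,\ldots,F_n\in\mathcal{B}$. $Ctbl(X)$ is the normal subgroup of all $T\in Aut(X,\mathcal{B})$ such that $\{x\in X: Tx\neq x\}$ is at most countable. $p_0$ is the quotient topology on $Aut_0(X,\mathcal{B})$ induced by $p$. An automorphism $T\in Aut(X,\mathcal{B})$ is aperiodic if every $T$-orbit $\{T^nx : n\in\mathbb{Z}\}$ is infinite; it is smooth if there is a Borel set $A\subset X$ which meets every $T$-orbit exactly once. The conjugation action of a topological group $G$ on itself is topologically transitive if for all nonempty open $U,V\subset G$ there is $g\in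 G$ with $g^{-1}Ug\cap V\ne\emptyset$. *)

(* Defs.v *)
From HB Require Import structures.
From mathcomp Require Import all_boot all_order all_algebra finmap.
From mathcomp Require Import all_classical all_reals all_analysis.

Set Implicit Arguments.
Unset Strict Implicit.
Unset Printing Implicit Defensive.

Local Open Scope classical_set_scope.
Local Open Scope group_scope.
Local Open Scope quotient_scope.

Definition polish (R : realType) (M : metricType R) : Prop :=
  (exists2 D : set M, countable D & dense D) /\
  (forall u : nat -> M, cauchy (u @ \oo) -> exists l : M, u @ \oo --> l).

(* [X] is isomorphic, as a measurable space, to a Polish space with its Borel
   sets; [<<s @open M >>] is the sigma-algebra generated by the open sets. *)
Definition standard_borel (R : realType) d (X : measurableType d) : Prop :=
  exists2 M : metricType R, polish M &
  exists2 f : M -> X, bijective f &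
    forall A : set X, measurable A <-> <<s @open M >> (f @^-1` A).

HB.mixin Record Group_Topological_isTopologicalGroup G
    of Group G & Topological G := {
  mulg_continuous : continuous (fun xy : G * G => (xy.1 : G) * xy.2);
  invg_continuous : continuous (fun x : G => x^-1)
}.

#[short(type="topologicalGroupType")]
HB.structure Definition TopologicalGroup :=
  {G of Group G & Topological G & Group_Topological_isTopologicalGroup G}.

Definition conj_topologically_transitive (G : topologicalGroupType) : Prop :=
  forall U V : set G, open U -> U !=set0 -> open V -> V !=set0 ->
  exists g : G, [set g^-1 * u * g | u in U] `&` V !=set0.

Record baut d (X : measurableType d) := Baut {
  baut_fun :> X -> X;
  baut_inv : X -> X;
  baut_funK : cancel baut_fun baut_inv;
  baut_invK : cancel baut_inv baut_fun;
  measurable_baut : measurable_fun [set: X] baut_fun;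
  measurable_baut_inv : measurable_fun [set: X] baut_inv
}.

Bind Scope group_scope with baut.

HB.instance Definition _ d (X : measurableType d) := gen_eqMixin (baut X).
HB.instance Definition _ d (X : measurableType d) := gen_choiceMixin (baut X).

Section BautGroup.
Context d (X : measurableType d).
Implicit Types S T : baut X.

Lemma bautP S T : S =1 T -> S = T.
Proof.
case: S T => [f f' fK f'K mf mf'] [g g' gK g'K mg mg'] /= fg.
have {fg} efg : f = g by apply/funext.
subst g.
have e' : f' = g' by apply/funext => x; rewrite -[in LHS](g'K x) fK.
subst g'.
by congr Baut; exact: Prop_irrelevance.
Qed.

Definition baut_one : baut X :=
  @Baut d X id id (fun=> erefl) (fun=> erefl)
    (@measurable_id _ _ _) (@measurable_id _ _ _).

Definition baut_opp T : baut X :=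
  @Baut d X (baut_inv T) T (baut_invK T) (baut_funK T)
    (measurable_baut_inv T) (measurable_baut T).

Definition baut_mul S T : baut X :=
  @Baut d X (S \o T) (baut_inv T \o baut_inv S)
    (can_comp (baut_funK S) (baut_funK T))
    (can_comp (baut_invK T) (baut_invK S))
    (measurableT_comp (measurable_baut S) (measurable_baut T))
    (measurableT_comp (measurable_baut_inv T) (measurable_baut_inv S)).

Lemma baut_mulA : associative baut_mul.
Proof. by move=> S T U; exact: bautP. Qed.
Lemma baut_mul1g : left_id baut_one baut_mul.
Proof. by move=> S; exact: bautP. Qed.
Lemma baut_mulg1 : right_id baut_one baut_mul.
Proof. by move=> S; exact: bautP. Qed.
Lemma baut_mulVg : left_inverse baut_one baut_opp baut_mul.
Proof. by move=> S; apply: bautP => x; exact: baut_funK. Qed.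
Lemma baut_mulgV : right_inverse baut_one baut_opp baut_mul.
Proof. by move=> S; apply: bautP => x; exact: baut_invK. Qed.

HB.instance Definition _ := isGroup.Build (baut X)
  baut_mulA baut_mul1g baut_mulg1 baut_mulVg baut_mulgV.
HB.instance Definition _ := isPointed.Build (baut X) (1 : baut X).

Lemma bautME S T x : (S * T) x = S (T x). Proof. by []. Qed.
Lemma baut1E x : (1 : baut X) x = x. Proof. by []. Qed.
Lemma bautKV T x : T (T^-1 x) = x. Proof. exact: baut_invK. Qed.
Lemma bautVK T x : T^-1 (T x) = x. Proof. exact: baut_funK. Qed.

End BautGroup.

Section WeakTopology.
Context d (X : measurableType d).
Implicit Types S T : baut X.

Definition weak_nbhd T (Fs : {fset (set X)}) : set (baut X) :=
  [set S : baut X | forall F, F \in Fs -> S @` F = T @` F].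

Definition borel_fam : set (baut X * {fset (set X)}) :=
  [set TFs | forall F, F \in TFs.2 -> measurable F].

Lemma weak_cover :
  \bigcup_(TFs in borel_fam) weak_nbhd TFs.1 TFs.2 = [set: baut X].
Proof.
by rewrite -subTset => T _; exists (T, fset0) => // F; rewrite in_fset0.
Qed.

Lemma weak_join (i j : baut X * {fset (set X)}) (S : baut X) :
  borel_fam i -> borel_fam j ->
  weak_nbhd i.1 i.2 S -> weak_nbhd j.1 j.2 S ->
  exists k, [/\ borel_fam k, weak_nbhd k.1 k.2 S &
    weak_nbhd k.1 k.2 `<=` weak_nbhd i.1 i.2 `&` weak_nbhd j.1 j.2].
Proof.
move=> mi mj iS jS; exists (S, (i.2 `|` j.2)%fset); split => //=.
- by move=> F; rewrite in_fsetU => /orP[/mi|/mj].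
- move=> U US; split=> F Fi.
  + by rewrite US ?in_fsetU ?Fi//; exact: iS.
  + by rewrite US ?in_fsetU ?Fi ?orbT//; exact: jS.
Qed.

(* The topology whose base consists of the sets W(T; F_1, .., F_n) with the F_i
   Borel. *)
HB.instance Definition _ :=
  isBaseTopological.Build (baut X) weak_cover weak_join.

End WeakTopology.

Section WeakTopologyTheory.
Context d (X : measurableType d).
Implicit Types (S T : baut X) (Fs : {fset (set X)}).

Lemma weak_open T Fs : borel_fam (T, Fs) -> open (weak_nbhd T Fs).
Proof.
move=> mFs; exists [set (T, Fs)]; first by move=> _ ->.
by rewrite bigcup_set1.
Qed.

Lemma weak_nbhsE T (N : set (baut X)) :
  nbhs T N <-> exists2 Fs, borel_fam (T, Fs) & weak_nbhd T Fs `<=` N.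
Proof.
split; last first.
  move=> [Fs mFs sN]; rewrite nbhsE; exists (weak_nbhd T Fs) => //.
  by split => //; exact: weak_open.
rewrite nbhsE => -[_ [[D sD <-] [[S Fs] /= DS TS]] sN].
exists Fs; first by move=> F FFs; exact: (sD _ DS).
move=> U UT; apply: sN; exists (S, Fs) => // F FFs /=.
by rewrite UT// TS.
Qed.

Lemma baut_measurable_image T (F : set X) : measurable F -> measurable (T @` F).
Proof.
move=> mF; rewrite (_ : T @` F = T^-1%g @^-1` F).
  rewrite -[_ @^-1` _]setTI.
  exact: (measurable_baut (T^-1)).
apply/seteqP; split=> [_ [x Fx <-]|y Fy].
  by rewrite /preimage /mkset bautVK.
by exists (T^-1 y) => //; rewrite bautKV.
Qed.

Lemma bautM_image S T (F : set X) : (S * T) @` F = S @` (T @` F).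
Proof. by rewrite image_comp. Qed.

Lemma bautVK_image T (F : set X) : T^-1%g @` (T @` F) = F.
Proof.
rewrite image_comp -[RHS]image_id; apply: eq_imagel => x _ /=.
exact: bautVK.
Qed.

Lemma bautKV_image T (F : set X) : T @` (T^-1%g @` F) = F.
Proof. by rewrite -{1}[T]invgK bautVK_image. Qed.

Definition baut_images T Fs : {fset (set X)} :=
  ((fun F : set X => (T @` F)%classic) @` Fs)%fset.

Lemma baut_mul_continuous :
  continuous (fun ST : baut X * baut X => (ST.1 : baut X) * ST.2).
Proof.
move=> [S T] /= N /weak_nbhsE[Fs mFs sN].
pose TFs := baut_images T Fs.
exists (weak_nbhd S TFs, weak_nbhd T Fs) => /=; last first.
  move=> [S' T'] /= [S'S T'T]; apply: sN => F FFs /=.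
  rewrite !bautM_image T'T// S'S//.
  by apply/imfsetP; exists F.
split; apply/weak_nbhsE; last by exists Fs.
by exists TFs => // _ /imfsetP[F FFs ->]; exact/baut_measurable_image/mFs.
Qed.

Lemma baut_inv_continuous : continuous (fun T : baut X => T^-1).
Proof.
move=> T N /weak_nbhsE[Fs mFs sN].
apply/weak_nbhsE; exists (baut_images T^-1 Fs).
  by move=> _ /imfsetP[F FFs ->]; apply: baut_measurable_image; exact: mFs.
move=> S ST; apply: sN => F FFs.
have /ST : (T^-1%g @` F) \in baut_images T^-1 Fs.
  by apply/imfsetP; exists F.
by rewrite bautKV_image => SF; rewrite -[in LHS]SF bautVK_image.
Qed.

HB.instance Definition _ := Group_Topological_isTopologicalGroup.Build (baut X)
  baut_mul_continuous baut_inv_continuous.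

End WeakTopologyTheory.

Section Ctbl.
Context d (X : measurableType d).
Implicit Types S T : baut X.

Definition ctbl : set (baut X) := [set T : baut X | countable [set x | T x <> x]].

Lemma ctbl1 : ctbl 1.
Proof.
rewrite /ctbl /= (_ : [set _ | _] = set0); first exact: countable0.
by rewrite -subset0 => x; exact.
Qed.

Lemma ctblM S T : ctbl S -> ctbl T -> ctbl (S * T).
Proof.
move=> cS cT; have cU : countable ([set x | S x <> x] `|` [set x | T x <> x]).
  by rewrite -bigcup2E; apply: bigcup_countable => // -[|[|]] //= _ _.
apply: sub_countable cU; apply: subset_card_le => x STx.
have [Tx|] := pselect (T x = x); last by right.
by left => Sx; apply: STx; rewrite bautME Tx Sx.
Qed.

Lemma ctblV T : ctbl T -> ctbl T^-1.
Proof.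
apply: sub_countable; apply: subset_card_le => x TVx Tx.
by apply: TVx; rewrite -{1}Tx bautVK.
Qed.

Lemma ctblJ S T : ctbl S -> ctbl (T^-1 * S * T).
Proof.
move=> cS; have cU : countable (T^-1%g @` [set x | S x <> x]).
  exact: sub_countable (card_image_le _ _) cS.
apply: sub_countable cU; apply: subset_card_le => x STx.
exists (T x) => /=; last exact: bautVK.
by move=> Sx; apply: STx; rewrite !bautME Sx bautVK.
Qed.

(* [S] and [T] are in the same left coset of the normal subgroup [ctbl]. *)
Definition eq_mod_ctbl : rel (baut X) := fun S T => `[< ctbl (S^-1 * T) >].

Lemma eq_mod_ctbl_refl : reflexive eq_mod_ctbl.
Proof. by move=> S; apply/asboolP; rewrite mulVg; exact: ctbl1. Qed.

Lemma eq_mod_ctbl_sym : symmetric eq_mod_ctbl.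
Proof.
move=> S T; apply/asboolP/asboolP => /ctblV; by rewrite invgM invgK.
Qed.

Lemma eq_mod_ctbl_trans : transitive eq_mod_ctbl.
Proof.
move=> T S U /asboolP ST /asboolP TU; apply/asboolP.
by have := ctblM ST TU; rewrite mulgA mulgK.
Qed.

Canonical eq_mod_ctbl_equiv :=
  EquivRel eq_mod_ctbl eq_mod_ctbl_refl eq_mod_ctbl_sym eq_mod_ctbl_trans.

Definition aut0 : Type := quotient_topology {eq_quot eq_mod_ctbl}.

HB.instance Definition _ := Topological.copy aut0
  (quotient_topology {eq_quot eq_mod_ctbl}).
HB.instance Definition _ := Quotient.copy aut0 {eq_quot eq_mod_ctbl}.

Lemma aut0P S T : \pi_aut0 S = \pi_aut0 T <-> ctbl (S^-1 * T).
Proof.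
split=> [/eqmodP/asboolP//|ST].
by apply/eqmodP/asboolP.
Qed.

Definition aut0_one : aut0 := \pi_aut0 1.
Definition aut0_inv (s : aut0) : aut0 := \pi_aut0 (repr s)^-1.
Definition aut0_mul (s t : aut0) : aut0 := \pi_aut0 (repr s * repr t).

Lemma aut0_piV S : \pi_aut0 S^-1 = aut0_inv (\pi_aut0 S).
Proof.
apply/aut0P; rewrite invgK.
have /aut0P := reprK (\pi_aut0 S).
move: (repr _) => R RS; have := ctblJ R^-1 RS.
by rewrite invgK mulgA mulgV mul1g.
Qed.

Lemma aut0_piM S T : \pi_aut0 (S * T) = aut0_mul (\pi_aut0 S) (\pi_aut0 T).
Proof.
apply/esym/aut0P.
have /aut0P := reprK (\pi_aut0 S); have /aut0P := reprK (\pi_aut0 T).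
move: (repr (\pi_aut0 S)) (repr (\pi_aut0 T)) => R Q QT RS.
have := ctblM (ctblJ Q RS) QT.
by rewrite invgM !mulgA mulgK.
Qed.

Lemma aut0_ind (P : aut0 -> Prop) : (forall S, P (\pi_aut0 S)) -> forall s, P s.
Proof. by move=> Ppi s; rewrite -[s]reprK. Qed.

Lemma aut0_mulA : associative aut0_mul.
Proof.
elim/aut0_ind=> S; elim/aut0_ind=> T; elim/aut0_ind=> U.
by rewrite -!aut0_piM mulgA.
Qed.
Lemma aut0_mul1g : left_id aut0_one aut0_mul.
Proof. by elim/aut0_ind=> S; rewrite -aut0_piM mul1g. Qed.
Lemma aut0_mulg1 : right_id aut0_one aut0_mul.
Proof. by elim/aut0_ind=> S; rewrite -aut0_piM mulg1. Qed.
Lemma aut0_mulVg : left_inverse aut0_one aut0_inv aut0_mul.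
Proof. by elim/aut0_ind=> S; rewrite -aut0_piV -aut0_piM mulVg. Qed.
Lemma aut0_mulgV : right_inverse aut0_one aut0_inv aut0_mul.
Proof. by elim/aut0_ind=> S; rewrite -aut0_piV -aut0_piM mulgV. Qed.

HB.instance Definition _ := isGroup.Build aut0
  aut0_mulA aut0_mul1g aut0_mulg1 aut0_mulVg aut0_mulgV.

Lemma piV S : \pi_aut0 S^-1 = (\pi_aut0 S)^-1.
Proof. exact: aut0_piV. Qed.

Lemma piM S T : \pi_aut0 (S * T) = \pi_aut0 S * \pi_aut0 T.
Proof. exact: aut0_piM. Qed.

End Ctbl.

Section Aut0Topology.
Context d (X : measurableType d).
Implicit Types S T : baut X.
Local Notation aut0 := (aut0 X).

Lemma aut0_openE (U : set aut0) : open U <-> open (\pi_aut0 @^-1` U).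
Proof. by []. Qed.

Lemma aut0_pi_continuous : continuous (\pi_aut0 : baut X -> aut0).
Proof. by apply/continuousP => U. Qed.

Lemma baut_mulr_continuous T : continuous (fun S : baut X => S * T).
Proof.
move=> S N /(@baut_mul_continuous _ _ (S, T)) [[A B] /= [SA TB] AB].
apply: filterS SA => S' AS'.
exact: (AB (S', T) (conj AS' (nbhs_singleton TB))).
Qed.

Lemma aut0_pi_open (U : set (baut X)) : open U -> open (\pi_aut0 @` U).
Proof.
move=> oU; apply/aut0_openE.
rewrite (_ : _ @^-1` _ =
    \bigcup_(C in ctbl (X := X)) ((fun S => S * C) @^-1` U)).
  apply: bigcup_open => C _; move/continuousP: (@baut_mulr_continuous C).
  exact.
apply/seteqP; split=> [T [S US /esym/aut0P cST]|T [C cC UTC]].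
  by exists (T^-1 * S) => //=; rewrite mulVKg.
exists (T * C) => //; apply/esym/aut0P.
by rewrite mulKg.
Qed.

Lemma aut0_pi_nbhs S (N : set (baut X)) :
  nbhs S N -> nbhs (\pi_aut0 S) (\pi_aut0 @` N).
Proof.
rewrite !nbhsE => -[U [oU US] UN]; exists (\pi_aut0 @` U).
  by split; [exact: aut0_pi_open|exists S].
exact: image_subset.
Qed.

Lemma aut0_mul_continuous :
  continuous (fun st : aut0 * aut0 => (st.1 : aut0) * st.2).
Proof.
move=> [s t]; elim/aut0_ind: s => S; elim/aut0_ind: t => T /= N.
rewrite -piM => /aut0_pi_continuous/(@baut_mul_continuous _ _ (S, T)).
move=> [[A B] [/= SA TB] AB].
exists (\pi_aut0 @` A, \pi_aut0 @` B) => /=.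
  by split; exact: aut0_pi_nbhs.
move=> _ /= [[S' AS' <-] [T' BT' <-]].
by rewrite /= -piM; exact: (AB (S', T')).
Qed.

Lemma aut0_inv_continuous : continuous (fun s : aut0 => s^-1).
Proof.
move=> s; elim/aut0_ind: s => S N.
rewrite -piV => /aut0_pi_continuous/baut_inv_continuous/aut0_pi_nbhs.
apply: filterS => _ [T NT <-]; rewrite /preimage /mkset -piV; exact: NT.
Qed.

HB.instance Definition _ := Group_Topological_isTopologicalGroup.Build aut0
  aut0_mul_continuous aut0_inv_continuous.

End Aut0Topology.

Section Dynamics.
Context d (X : measurableType d).
Implicit Types T : baut X.

Definition baut_orbit T (x : X) : set X :=
  [set (T ^+ n) x | n in [set: nat]] `|` [set (T ^- n) x | n in [set: nat]].

Definition aperiodic T : Prop := forall x, infinite_set (baut_orbit T x).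

Definition smooth T : Prop :=
  exists2 A : set X, measurable A & forall x, exists! y, (A `&` baut_orbit T x) y.

End Dynamics.

(* Main.v *)
Require Import Defs.
From HB Require Import structures.
From mathcomp Require Import all_boot all_order all_algebra finmap.
From mathcomp Require Import all_classical all_reals all_analysis.
From mathcomp Require Import lra.

(** Bringing a conjugate of [S] close to [T] is a matter of colors: a basic
    neighborhood of [T] is determined by the coloring [k] of the space by the
    membership pattern in the finitely many given Borel sets, and [U] lies in
    it as soon as [k (U^-1 y) = k (T^-1 y)] for all [y].

    Record the action of [T] on colors by the directed graph whose edges are
    the pairs [(k (T^-1 x), k x)] that occur for uncountably many [x]; all other
    pairs together involve countably many points only.  Every edge is followed
    and preceded by another one, since [T] carries an uncountable set to an
    uncountable set.  A smooth aperiodic [S] is the shift on A x Z with A an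
    uncountable Borel set, so cutting A into uncountable Borel pieces, one per
    edge, and letting each orbit of [S] follow a bi-infinite walk through the
    edge of its piece labels the whole space by edges in such a way that [S]
    moves along consecutive edges and every edge labels an uncountable set
    ([clock_walk]).  The labelling by edges that comes from [T] and the one that
    comes from [S] are two Borel colorings with uncountable classes, so a Borel
    automorphism [R] carries the first to the second
    ([uncountable_colorings_conjugate]).  Then [R^-1 * S * R] moves colors as [T]
    does off a countable set, and a countably supported correction makes this
    exact ([countable_correction], [clock_conjugate_coloring]).

    Transitivity follows from the density of a single conjugacy class, once one
    smooth aperiodic automorphism is known: color the space by integers with
    uncountable classes and conjugate the coloring with its translate by one
    ([clock_exists]).

    The tool behind all this is the Borel isomorphism theorem, in the form that
    two Borel partitions into uncountable sets, indexed by the same countable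
    set, are isomorphic.  A standard Borel space is a measurable retract of the
    Cantor space ([standard_borel_retract]); this is where completeness enters,
    and it makes images under split injections measurable.  An uncountable Borel
    set of the Cantor space contains a copy of the Cantor space
    ([cantor_embeds]): it is the projection of a closed set, in which a Cantor
    scheme is built.  The Schroeder-Bernstein argument concludes
    ([borel_schroeder_bernstein]). *)

Set Implicit Arguments.
Unset Strict Implicit.
Unset Printing Implicit Defensive.
Import Order.TTheory GRing.Theory Num.Theory.

Local Open Scope classical_set_scope.

(** * Countable sets and countably valued measurable colorings *)

Lemma sub_countable_set T (A B : set T) :
  A `<=` B -> countable B -> countable A.
Proof. by move=> /subset_card_le; exact: sub_countable. Qed.

Lemma countable_preimage_inj T U (f : T -> U) (A : set U) :
  injective f -> countable A -> countable (f @^-1` A).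
Proof.
move=> fI /countable_injP[g gI]; apply/countable_injP; exists (g \o f).
move=> x y; rewrite !inE => Ax Ay gxy.
by apply: fI; apply: gI => //; rewrite inE.
Qed.

Lemma measurable_prop d (T : measurableType d) (P : Prop) :
  measurable [set _ : T | P].
Proof.
have [p|np] := pselect P.
- by rewrite (_ : [set _ | _] = setT)//; apply/seteqP; split.
- by rewrite (_ : [set _ | _] = set0)//; apply/seteqP; split.
Qed.

Lemma countable_setU T (A B : set T) :
  countable A -> countable B -> countable (A `|` B).
Proof.
move=> cA cB; rewrite -bigcup2E.
by apply: bigcup_countable => // -[|[|]] //= _ _.
Qed.

Lemma measurable_exists d (T : measurableType d) (I : countType)
    (P : I -> T -> Prop) :
  (forall i, measurable [set x | P i x]) ->
  measurable [set x | exists i, P i x].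
Proof.
move=> mP; rewrite (_ : [set _ | _] = \bigcup_i [set x | P i x]).
  exact: countable_bigcupT_measurable.
by apply/seteqP; split=> x [i]; exists i.
Qed.

Lemma measurable_forall d (T : measurableType d) (I : countType)
    (P : I -> T -> Prop) :
  (forall i, measurable [set x | P i x]) ->
  measurable [set x | forall i, P i x].
Proof.
move=> mP; rewrite (_ : [set _ | _] = ~` [set x | exists i, ~ P i x]).
  apply: measurableC; apply: measurable_exists => i.
  exact: (measurableC (mP i)).
apply/seteqP; split=> x /= => [Px [i]|/forallNP nP i]; first exact.
exact: contrapT.
Qed.

(** For a countable type of colors this is measurability with respect to the
    discrete sigma-algebra. *)
Definition measurable_coloring d (T : measurableType d) (I : Type)
  (a : T -> I) := forall i, measurable (a @^-1` [set i]).

Section Colorings.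
Context d (T : measurableType d).

Lemma measurable_coloring_preimage (I : countType) (a : T -> I) (P : set I) :
  measurable_coloring a -> measurable (a @^-1` P).
Proof.
move=> ma.
rewrite (_ : _ @^-1` _ = \bigcup_i (a @^-1` [set i] `&` [set _ | P i])).
  apply: countable_bigcupT_measurable => // i; apply: measurableI => //.
  exact: measurable_prop.
apply/seteqP; split=> [x Px|x [i _ [/= <-]]//].
by exists (a x).
Qed.

Lemma measurable_coloring_comp (I : countType) (J : Type) (f : I -> J)
    (a : T -> I) :
  measurable_coloring a -> measurable_coloring (f \o a).
Proof.
by move=> ma j; exact: (measurable_coloring_preimage (f @^-1` [set j]) ma).
Qed.

Lemma measurable_coloring_pair (I J : Type) (a : T -> I) (b : T -> J) :
  measurable_coloring a -> measurable_coloring b ->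
  measurable_coloring (fun x => (a x, b x)).
Proof.
move=> ma mb [i j].
rewrite (_ : _ @^-1` _ = (a @^-1` [set i]) `&` (b @^-1` [set j])).
  exact: measurableI.
by apply/seteqP; split=> x /= [-> ->].
Qed.

Lemma measurable_coloring_bool (A : set T) :
  measurable A -> measurable_coloring (fun x => `[< A x >]).
Proof.
move=> mA [].
  rewrite (_ : _ @^-1` _ = A)//.
  by apply/seteqP; split=> x /= /asboolP.
rewrite (_ : _ @^-1` _ = ~` A); first exact: measurableC.
apply/seteqP; split=> x /=; first by move=> h /asboolP; rewrite h.
by move=> nA; apply/negbTE/asboolP.
Qed.

Lemma measurable_coloring_map d' (U : measurableType d') (I : Type)
    (f : U -> T) (a : T -> I) :
  measurable_fun setT f -> measurable_coloring a ->
  @measurable_coloring _ U _ (a \o f).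
Proof.
move=> mf ma i; rewrite -[X in measurable X]setTI.
exact: (mf measurableT _ (ma i)).
Qed.

Lemma measurable_coloring_glue (I J : countType) (a : T -> I)
    (b : I -> T -> J) :
  measurable_coloring a -> (forall i, measurable_coloring (b i)) ->
  measurable_coloring (fun x => b (a x) x).
Proof.
move=> ma mb j.
rewrite (_ : _ @^-1` _ = \bigcup_i (a @^-1` [set i] `&` b i @^-1` [set j])).
  by apply: countable_bigcupT_measurable => // i; apply: measurableI;
    [exact: ma|exact: mb].
apply/seteqP; split=> [x /= bx|x [i _ [/= <-]]//].
by exists (a x).
Qed.

End Colorings.

Lemma measurable_preimageT d d' (T : measurableType d) (U : measurableType d')
    (f : T -> U) (A : set U) :
  measurable_fun setT f -> measurable A -> measurable (f @^-1` A).
Proof. by move=> mf mA; rewrite -[X in measurable X]setTI; exact: mf. Qed.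

Lemma measurable_fun_glue d d' (T : measurableType d) (U : measurableType d')
    (I : countType) (a : T -> I) (f : I -> T -> U) :
  measurable_coloring a -> (forall i, measurable_fun setT (f i)) ->
  measurable_fun setT (fun x => f (a x) x).
Proof.
move=> ma mf _ A mA; rewrite setTI.
rewrite (_ : _ @^-1` _ = \bigcup_i (a @^-1` [set i] `&` f i @^-1` A)).
  apply: countable_bigcupT_measurable => // i; apply: measurableI;
    [exact: ma|exact: measurable_preimageT].
apply/seteqP; split=> [x /= fx|x [i _ [/= <-]]//].
by exists (a x).
Qed.

Lemma measurable_fun_cases d d' (T : measurableType d) (U : measurableType d')
    (Z : set T) (f g : T -> U) : measurable Z ->
  measurable_fun setT f -> measurable_fun setT g ->
  measurable_fun setT (fun x => if `[< Z x >] then f x else g x).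
Proof.
move=> mZ mf mg.
apply: (@measurable_fun_glue _ _ _ _ bool (fun x => `[< Z x >])
  (fun b x => if b then f x else g x)); first exact: measurable_coloring_bool.
by case.
Qed.

(** * The Cantor space and its analytic sets *)

Section Cantor.

Definition cylinders : set (set (nat -> bool)) :=
  [set A | exists n, A = [set c : nat -> bool | c n]].

Definition cantor := g_sigma_algebraType cylinders.

Lemma cylinder_measurable n :
  measurable ([set c : nat -> bool | c n] : set cantor).
Proof. by apply: sub_sigma_algebra; exists n. Qed.

Lemma measurable_coord n : measurable_coloring (fun c : cantor => c n).
Proof.
rewrite (_ : (fun c : cantor => c n) =
    (fun c : cantor => `[< [set c : nat -> bool | c n] c >])).
  exact: measurable_coloring_bool (cylinder_measurable n).
by apply/funext => c /=; rewrite asboolb.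
Qed.

Lemma measurable_to_cantor d (T : measurableType d) (f : T -> cantor) :
  (forall n, measurable_coloring (fun x => f x n)) -> measurable_fun setT f.
Proof.
move=> mf; apply: (@measurability _ _ _ _ setT f cylinders) => //.
move=> _ [_ [n ->] <-]; rewrite setTI.
exact: (mf n true).
Qed.

Definition agree (I : Type) n (x y : nat -> I) :=
  forall i, (i < n)%N -> x i = y i.

Lemma agreeP (I : Type) n (x y : nat -> I) :
  mkseq x n = mkseq y n <-> agree n x y.
Proof.
split=> [e i ltin|xy]; last first.
  by apply/eq_in_map => i; rewrite mem_iota => /andP[_]; exact: xy.
by have := congr1 (fun s => nth (x i) s i) e; rewrite !nth_mkseq.
Qed.

Lemma agree_le (I : Type) m n (x y : nat -> I) :
  (m <= n)%N -> agree n x y -> agree m x y.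
Proof. by move=> mn xy i im; apply: xy; exact: leq_trans mn. Qed.

Lemma agree_trans (I : Type) n (x y z : nat -> I) :
  agree n x y -> agree n y z -> agree n x z.
Proof. by move=> xy yz i ltin; rewrite xy// yz. Qed.

Lemma agree_sym (I : Type) n (x y : nat -> I) : agree n x y -> agree n y x.
Proof. by move=> xy i ltin; rewrite xy. Qed.

Lemma measurable_prefix n : measurable_coloring (fun c : cantor => mkseq c n).
Proof.
elim: n => [|n IHn].
  by move=> w; exact: (@measurable_prop _ cantor ([::] = w)).
have /(measurable_coloring_comp (fun p => rcons p.1 p.2)) :=
  measurable_coloring_pair IHn (measurable_coord n).
rewrite (_ : _ \o _ = (fun c : cantor => mkseq c n.+1))//.
by apply/funext => c /=; rewrite mkseqS.
Qed.

Lemma prefix_determined_measurable (I : Type) (f : cantor -> I) n :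
  (forall c c' : nat -> bool, agree n c c' -> f c = f c') ->
  measurable_coloring f.
Proof.
move=> fE.
rewrite (_ : f = (fun w => f (nth false w)) \o (fun c : cantor => mkseq c n)).
  exact: measurable_coloring_comp (@measurable_prefix n).
apply/funext => c /=; apply: fE => i ltin.
by rewrite nth_mkseq.
Qed.

(** Closedness of the graph of [K] in the product of the Cantor space and the
    Baire space, stated through approximation by prefixes. *)
Definition closed_rel (K : (nat -> bool) -> (nat -> nat) -> Prop) :=
  forall x s,
    (forall n, exists x' s', [/\ K x' s', agree n x x' & agree n s s']) ->
    K x s.

Definition analytic (A : set (nat -> bool)) :=
  exists2 K, closed_rel K & forall x, A x <-> exists s, K x s.

(** The first term of the witness tells which set of the union is meant. *)
Lemma analytic_bigcup (A : nat -> set (nat -> bool)) :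
  (forall n, analytic (A n)) -> analytic (\bigcup_n A n).
Proof.
move=> /(_ _)/cid2-/all_sig[K /all_and2[cK KA]].
exists (fun x s => K (s 0%N) x (fun i => s i.+1)).
- move=> x s xs; apply: cK => n.
  have [x' [s' [Kx' xx' ss']]] := xs n.+1.
  exists x', (fun i => s' i.+1); split.
  + by rewrite ss'.
  + exact: agree_le xx'.
  + by move=> i ltin; exact: ss'.
- move=> x; split=> [[n _ /KA[s Ks]]|[s Ks]].
  + by exists (fun i => if i is j.+1 then s j else n).
  + by exists (s 0%N) => //; apply/KA; eexists; exact: Ks.
Qed.

(** A single witness codes a sequence of witnesses through a pairing of the
    natural numbers; finitely many terms of each of them are determined by a
    long enough prefix of the code, which keeps the relation closed. *)
Lemma analytic_bigcap (A : nat -> set (nat -> bool)) :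
  (forall n, analytic (A n)) -> analytic (\bigcap_n A n).
Proof.
move=> /(_ _)/cid2-/all_sig[K /all_and2[cK KA]].
exists (fun x s => forall n, K n x (fun i => s (choice.pickle (n, i)))).
- move=> x s xs n; apply: cK => m.
  pose N := \max_(i < m) (choice.pickle (n, i : nat)).+1.
  have [x' [s' [Kx' xx' ss']]] := xs (maxn m N).
  exists x', (fun i => s' (choice.pickle (n, i))); split => //.
  + by apply: agree_le xx'; exact: leq_maxl.
  + move=> i ltim; apply: ss'; rewrite leq_max; apply/orP; right.
    exact: (@leq_bigmax _ (fun i : 'I_m => (choice.pickle (n, i : nat)).+1)
      (Ordinal ltim)).
- move=> x; split=> [Ax|[s Ks] n _].
  + have /(_ _)/cid-/all_sig[s Ks] : forall n, exists s, K n x s.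
      by move=> n; apply/KA; exact: Ax.
    exists (fun m => if choice.unpickle m is Some p then s p.1 p.2 else 0%N).
    move=> n; rewrite (_ : (fun _ => _) = s n)//.
    by apply/funext => i; rewrite choice.pickleK.
  + by apply/KA; eexists; exact: Ks.
Qed.

(** Analytic sets are not closed under complement, but the sets which are
    analytic together with their complement form a sigma-algebra, and it
    contains the cylinders. *)
Lemma measurable_analytic (A : set cantor) : measurable A -> analytic A.
Proof.
suff : <<s cylinders >> `<=` [set A | analytic A /\ analytic (~` A)].
  by move=> /[apply] -[].
apply: smallest_sub.
  split=> /=.
  - split.
    + exists (fun _ _ => False); first by move=> x s /(_ 0%N)[? [? []]].
      by move=> x; split=> // -[].
    + exists (fun _ _ => True) => // x; split=> [_|_ []//].
      by exists (fun=> 0%N).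
  - by move=> B [aB aCB]; rewrite setTD setCK.
  - move=> F aF; split; first by apply: analytic_bigcup => n; have [] := aF n.
    by rewrite setC_bigcup; apply: analytic_bigcap => n; have [] := aF n.
have aE n b : analytic [set c | c n = b].
  exists (fun x _ => x n = b).
    by move=> x s /(_ n.+1)[x' [s' [<- + _]]]; exact.
  by move=> x; split=> [|[]//]; exists (cst 0%N).
move=> _ [n ->]; split=> /=.
- exact: aE n true.
- rewrite (_ : ~` _ = [set c | c n = false])//.
  by apply/seteqP; split=> c /=; case: (c n).
Qed.

End Cantor.

(** * The perfect set theorem for Borel sets of the Cantor space *)

Section PerfectSet.
Variable K : (nat -> bool) -> (nat -> nat) -> Prop.
Hypothesis closedK : closed_rel K.

(** A node stands for the basic open box of the pairs that agree with its point
    and its witness up to its depth; only these prefixes matter. *)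
Record node := Node {
  node_pt : nat -> bool; node_wit : nat -> nat; node_depth : nat }.
Implicit Types p q : node.

Definition node_sec p : set (nat -> bool) := [set x | exists s,
  [/\ K x s, agree (node_depth p) (node_pt p) x &
      agree (node_depth p) (node_wit p) s]].

Definition big p := ~ countable (node_sec p).

Definition refines p q := [/\ (node_depth p < node_depth q)%N,
  agree (node_depth p) (node_pt p) (node_pt q) &
  agree (node_depth p) (node_wit p) (node_wit q)].

(** There are countably many boxes, so those with a countable section cover
    countably many points only: outside of these, and of a given countable
    set, every point is a condensation point. *)
Lemma big_point p (N : set (nat -> bool)) : big p -> countable N ->
  exists x s, [/\ ~ N x, agree (node_depth p) (node_pt p) x,
    agree (node_depth p) (node_wit p) s & forall n, big (Node x s n)].
Proof.
move=> bp cN; absurd_not => small; apply: bp.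
pose sec (w : seq bool * seq nat) : set (nat -> bool) :=
  [set x | exists s, [/\ K x s, mkseq x (size w.1) = w.1 &
                        mkseq s (size w.2) = w.2]].
suff : node_sec p `<=` N `|` \bigcup_(w in [set w | countable (sec w)]) sec w.
  move/sub_countable_set; apply; apply: countable_setU => //.
  exact: bigcup_countable.
move=> x [s [Kxs px ps]].
have [Nx|nNx] := pselect (N x); [by left|right].
have [n csec] := small x s nNx px ps.
exists (mkseq x n, mkseq s n); last by exists s; rewrite /= !size_mkseq.
apply: sub_countable_set csec => y [t [/= Kyt]].
rewrite !size_mkseq => /agreeP yx /agreeP ts.
by exists t; split => //; exact: agree_sym.
Qed.

Definition splits p (q : bool -> node) := [/\ forall b, big (q b),
  forall b, refines p (q b) &
  ~ agree (node_depth (q true)) (node_pt (q true)) (node_pt (q false)) /\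
  node_depth (q true) = node_depth (q false)].

(** Two condensation points with distinct first components are separated by
    deep enough boxes around them. *)
Lemma big_split p : big p -> exists q : bool -> node, splits p q.
Proof.
move=> bp.
have [x [s [_ px ps bx]]] := big_point bp (countable0 _).
have [y [t [/= yx py pt bY]]] := big_point bp (countable1 x).
have [i xyi] : exists i, x i <> y i.
  by apply/existsNP => xy; apply: yx; apply/funext => i; rewrite xy.
pose n := (maxn (node_depth p) i).+1.
exists (fun b => if b then Node x s n else Node y t n); split.
- by case.
- by case; split => //=; rewrite ltnS leq_maxl.
- by split => //= /(_ i); rewrite ltnS leq_maxr => /(_ isT).
Qed.

Variable root : node.
Hypothesis big_root : big root.

Lemma scheme_exists : exists child : node -> bool -> node,
  forall p, big p -> splits p (child p).
Proof.
have /(_ _)/cid-/all_sig[child childP] :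
    forall p, exists q : bool -> node, big p -> splits p q.
  move=> p; have [bp|nbp] := pselect (big p); last by exists (fun=> p).
  by have [q] := big_split bp; exists q.
by exists child.
Qed.

Let child := projT1 (cid scheme_exists).
Let childP p : big p -> splits p (child p).
Proof. exact: (projT2 (cid scheme_exists)). Qed.

Let walk (w : seq bool) := foldl child root w.

Let walk_rcons w b : walk (rcons w b) = child (walk w) b.
Proof. by rewrite /walk foldl_rcons. Qed.

Let big_walk w : big (walk w).
Proof.
elim/last_ind: w => [//|w b IHw]; rewrite walk_rcons.
by have [bc _ _] := childP IHw; exact: bc.
Qed.

Let at_ (c : nat -> bool) n := walk (mkseq c n).

Let at_S c n : at_ c n.+1 = child (at_ c n) (c n).
Proof. by rewrite /at_ mkseqS walk_rcons. Qed.

Let at_refines c n : refines (at_ c n) (at_ c n.+1).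
Proof.
rewrite at_S; have [_ r _] := childP (@big_walk (mkseq c n)); exact: r.
Qed.

Let at_depth c n : (n <= node_depth (at_ c n))%N.
Proof.
elim: n => // n IHn; have [lt _ _] := at_refines c n.
exact: leq_ltn_trans lt.
Qed.

Let at_mono c m n : (m <= n)%N ->
  agree (node_depth (at_ c m)) (node_pt (at_ c m)) (node_pt (at_ c n)) /\
  agree (node_depth (at_ c m)) (node_wit (at_ c m)) (node_wit (at_ c n)).
Proof.
elim: n => [|n IHn]; first by rewrite leqn0 => /eqP ->; split => i.
rewrite leq_eqVlt => /predU1P[-> //|]; rewrite ltnS => mn.
have [px ps] := IHn mn; have [_ qx qs] := at_refines c n.
have dmn : (node_depth (at_ c m) <= node_depth (at_ c n))%N.
  elim: n mn {IHn px ps qx qs} => [|n IHn]; first by rewrite leqn0 => /eqP ->.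
  rewrite leq_eqVlt => /predU1P[-> //|]; rewrite ltnS.
  by move=> /IHn/leq_trans; apply; have [/ltnW] := at_refines c n.
by split; [apply: agree_trans px _|apply: agree_trans ps _];
  exact: agree_le dmn _.
Qed.

(* The boxes along a branch are deeper than any given length, so their prefixes
   define a limit pair; it lies in [K] because [K] is closed and the boxes meet
   [K]. *)
Let branch (c : cantor) : cantor := fun i => node_pt (at_ c i.+1) i.
Let branch_wit (c : cantor) := fun i => node_wit (at_ c i.+1) i.

Let branch_agree c n :
  agree (node_depth (at_ c n)) (node_pt (at_ c n)) (branch c) /\
  agree (node_depth (at_ c n)) (node_wit (at_ c n)) (branch_wit c).
Proof.
split=> i lti; rewrite /branch /branch_wit; have [le|/ltnW le] := leqP n i.+1.
- by have [-> ] := at_mono c le.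
- by have [->] := at_mono c le; rewrite ?at_depth.
- by have [_ ->] := at_mono c le.
- by have [_ ->] := at_mono c le; rewrite ?at_depth.
Qed.

Let branch_in c : exists s, K (branch c) s.
Proof.
exists (branch_wit c); apply: closedK => n.
have [x [s [Kxs px ps]]] : node_sec (at_ c n) !=set0.
  apply: contrapT => /set0P/negP/negPn/eqP e0.
  by apply: (@big_walk (mkseq c n)); rewrite -/(at_ c n) /big e0.
have [bx bs] := branch_agree c n; have len := at_depth c n.
exists x, s; split => //.
- exact/(agree_le len)/(agree_trans (agree_sym bx)).
- exact/(agree_le len)/(agree_trans (agree_sym bs)).
Qed.

Let branch_measurable : measurable_fun setT branch.
Proof.
apply: measurable_to_cantor => i.
apply: (@prefix_determined_measurable _ _ i.+1) => c c' /agreeP cc'.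
by rewrite /branch /at_ cc'.
Qed.

(* The branch through which a point of the scheme passes is read off step by
   step, by asking whether the point lies in the first child. *)
Let test w (z : nat -> bool) :=
  `[< agree (node_depth (child (walk w) true))
            (node_pt (child (walk w) true)) z >].

Let path (z : cantor) := fix path n :=
  if n is m.+1 then rcons (path m) (test (path m) z) else [::].

Let code (z : cantor) : cantor := fun n => test (path z n) z.

Let code_measurable : measurable_fun setT code.
Proof.
have mtest w : measurable_coloring (fun z : cantor => test w z).
  apply: (@prefix_determined_measurable _ _
    (node_depth (child (walk w) true))) => z z' zz'.
  by apply/asbool_equiv_eq; split=> /agree_trans; apply => //; exact: agree_sym.
have mpath n : measurable_coloring (path ^~ n).
  elim: n => [|n IHn].
    by move=> w; exact: (@measurable_prop _ cantor ([::] = w)).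
  apply: (@measurable_coloring_glue _ cantor _ _ _
    (fun w z => rcons w (test w z)) IHn) => w.
  exact: measurable_coloring_comp (mtest w).
apply: measurable_to_cantor => n.
exact: measurable_coloring_glue (mpath n) mtest.
Qed.

Let test_branch c n : test (mkseq c n) (branch c) = c n.
Proof.
have [_ _ [dis dep]] := childP (@big_walk (mkseq c n)).
have [+ _] := branch_agree c n.+1; rewrite at_S /test -/(at_ c n).
case: (c n) => bc; first exact/asboolP.
apply/negbTE/asboolP => ac; apply: dis.
apply: (agree_trans ac); rewrite dep; exact: agree_sym.
Qed.

Let branchK c : code (branch c) = c.
Proof.
have pathE n : path (branch c) n = mkseq c n.
  by elim: n => //= n ->; rewrite test_branch mkseqS.
by apply/funext => n; rewrite /code pathE test_branch.
Qed.

Lemma perfect_set_scheme : exists f g : cantor -> cantor,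
  [/\ measurable_fun setT f, measurable_fun setT g, cancel f g &
      forall c, exists s, K (f c) s].
Proof. by exists branch, code. Qed.

End PerfectSet.

(** The left inverse [g] of the embedding comes with it, as a measurable map;
    it is what makes images under [f] measurable later. *)
Lemma cantor_embeds (A : set cantor) : measurable A -> ~ countable A ->
  exists f g : cantor -> cantor, [/\ measurable_fun setT f,
    measurable_fun setT g, cancel f g & forall c, A (f c)].
Proof.
move=> /measurable_analytic[K cK AK] uA.
have broot : big K (Node (fun=> false) (fun=> 0%N) 0).
  apply: contra_not uA; apply: sub_countable_set => x /AK[s Kxs].
  by exists s; split.
have [f [g [mf mg fK Kf]]] := perfect_set_scheme cK broot.
by exists f, g; split => // c; exact/AK.
Qed.

(** * Standard Borel spaces are retracts of the Cantor space *)

Section Polish.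
Local Open Scope ring_scope.
Variables (R : realType) (M : metricType R).
Hypothesis complete_M :
  forall u : nat -> M, cauchy (u @ \oo) -> exists l : M, u @ \oo --> l.
Variable p : nat -> M.
Hypothesis dense_p : dense (range p).

Let r k : R := k.+1%:R^-1.

Let r_gt0 k : 0 < r k. Proof. by rewrite /r invr_gt0. Qed.

Let r_small (e : R) : 0 < e -> exists k, r k < e.
Proof.
move=> e0; have [k _ kP] := near_infty_natSinv_lt (PosNum e0).
by exists k; exact: (kP k (leqnn _)).
Qed.

Let r_le k l : (k <= l)%N -> r l <= r k.
Proof. by move=> kl; rewrite /r lef_pV2 ?posrE// ler_nat. Qed.

Let open_ball (x : M) e : open (ball x e).
Proof.
rewrite openE => y; rewrite ballEmdist /= => xy.
rewrite /interior; apply/nbhs_ballP; exists (e - mdist x y) => /=.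
  by rewrite subr_gt0.
move=> z; rewrite !ballEmdist /= => yz.
by have := metric_triangle x y z; lra.
Qed.

Let p_near (x : M) k : exists n, mdist (p n) x < r k.
Proof.
have [|y [xy [n _ pn]]] := dense_p _ (open_ball x (r k)).
  by exists x; exact: ballxx.
by exists n; move: xy; rewrite ballEmdist /= pn metric_sym.
Qed.

(* A point is coded by the list of the balls of radius [r k] around the points
   [p n] that contain it; a code is good when its balls are compatible and of
   arbitrarily small radius, so that their centers converge. *)
Let in_ball (c : cantor) (k n : nat) := c (choice.pickle (k, n)).

Let good (c : cantor) := (forall k, exists n, in_ball c k n) /\
  (forall a : (nat * nat) * (nat * nat), in_ball c a.1.1 a.1.2 ->
    in_ball c a.2.1 a.2.2 ->
    mdist (p a.1.2) (p a.2.2) < r a.1.1 + r a.2.1).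

Let limit (c : cantor) (x : M) :=
  forall k n, in_ball c k n -> mdist (p n) x <= r k.

Let good_limit c : good c -> exists x, limit c x.
Proof.
move=> [] /(_ _)/cid-/all_sig[n cn] cc.
have [|x ux] := complete_M (u := p \o n).
  apply: cauchy_exP => e e0.
  have [k ke] := r_small (divr_gt0 e0 (ltr0n _ 2)).
  exists (p (n k)), k => // j /= kj.
  rewrite ballEmdist /=; have := cc ((k, n k), (j, n j)) (cn k) (cn j).
  rewrite /=; have := r_le kj; lra.
exists x => k m ckm; apply/ler_addgt0Pr => e e0.
have e20 := divr_gt0 e0 (ltr0n R 2).
have [j0 j0e] := r_small e20.
have [j1 _ j1x] := metricType_numDomainType.cvgr_dist_lt ux e20.
have := j1x (maxn j0 j1) (leq_maxr _ _); set j := maxn _ _ => /=.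
have := cc ((k, m), (j, n j)) ckm (cn j); rewrite /=.
have := metric_triangle (p m) (p (n j)) x; rewrite [mdist x _]metric_sym.
have := r_le (leq_maxl j0 j1 : (_ <= j)%N); lra.
Qed.

Let limit_unique c x y : good c -> limit c x -> limit c y -> x = y.
Proof.
move=> [ex _] cx cy; apply/mdist_positivity/eqP.
rewrite eq_le mdist_ge0 andbT; apply/ler_addgt0Pr => e e0; rewrite add0r.
have [k ke] := r_small (divr_gt0 e0 (ltr0n _ 2)).
have [n ckn] := ex k.
have := cx k n ckn; have := cy k n ckn.
have := metric_triangle x (p n) y; rewrite [mdist x (p n)]metric_sym; lra.
Qed.

Let decode (c : cantor) : M :=
  if pselect (good c) is left gc then projT1 (cid (good_limit gc)) else p 0%N.

Let decodeP c : good c -> limit c (decode c).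
Proof.
by rewrite /decode; case: pselect => // gc _; exact: (projT2 (cid _)).
Qed.

Definition polish_code (x : M) : cantor := fun m =>
  if choice.unpickle m is Some (k, n) then mdist (p n) x < r k else false.

Let in_ball_code x k n : in_ball (polish_code x) k n = (mdist (p n) x < r k).
Proof. by rewrite /in_ball /polish_code choice.pickleK. Qed.

Let good_code x : good (polish_code x).
Proof.
split=> [k|[[k n] [j m]] /=].
  by have [n] := p_near x k; exists n; rewrite in_ball_code.
rewrite !in_ball_code => kn jm; have := metric_triangle (p n) x (p m).
by rewrite [mdist x _]metric_sym; lra.
Qed.

Let codeK : cancel polish_code decode.
Proof.
move=> x; apply: (@limit_unique (polish_code x)); first exact: good_code.
  exact/decodeP/good_code.
by move=> k n; rewrite in_ball_code => /ltW.
Qed.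

Let measurable_in_ball k n : measurable [set c | in_ball c k n].
Proof. exact: cylinder_measurable. Qed.

Let measurable_good : measurable good.
Proof.
apply: measurableI.
  by apply: measurable_forall => k; exact: measurable_exists.
apply: measurable_forall => -[[k n] [j m]] /=.
have mkn := @measurable_coord (choice.pickle (k, n)).
have mjm := @measurable_coord (choice.pickle (j, m)).
exact: (measurable_coloring_preimage [set b : bool * bool | b.1 -> b.2 ->
  mdist (p n) (p m) < r k + r j] (measurable_coloring_pair mkn mjm)).
Qed.

(* The limit of a good code lies in [U] exactly when some closed ball of the
   code is contained in [U]: a condition on countably many coordinates. *)
Let decode_open (U : set M) : open U -> measurable (decode @^-1` U).
Proof.
move=> oU.
pose V (a : nat * nat) := [set y | mdist (p a.2) y <= r a.1] `<=` U.
rewrite (_ : _ @^-1` _ =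
    (good `&` [set c | exists a, in_ball c a.1 a.2 /\ V a]) `|`
    (~` good `&` [set _ | U (p 0%N)])).
  apply: measurableU; apply: measurableI => //.
  - apply: measurable_exists => a; apply: measurableI.
      exact: cylinder_measurable.
    exact: measurable_prop.
  - exact: measurableC.
  - exact: measurable_prop.
apply/seteqP; split=> c /=.
- move=> Uc; have [gc|ngc] := pselect (good c); last first.
    by right; split => //; move: Uc; rewrite /decode; case: pselect.
  left; split => //.
  have /nbhs_ballP[e /= e0 eU] : nbhs (decode c) U.
    by move: oU; rewrite openE; exact.
  have [k ke] := r_small (divr_gt0 e0 (ltr0n _ 2)).
  have [n ckn] := gc.1 k.
  exists (k, n); split => // y /= py; apply: eU; rewrite ballEmdist /=.
  have := decodeP gc ckn; have := metric_triangle (decode c) (p n) y.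
  by rewrite [mdist (decode c) (p n)]metric_sym; lra.
- case=> [[gc [[k n] [ckn +]]]|[ngc Up]].
    by apply; exact: decodeP gc _ _ ckn.
  by rewrite /decode; case: pselect.
Qed.

Lemma polish_retract : exists decode : cantor -> M,
  [/\ cancel polish_code decode,
      forall m, open [set x | polish_code x m] &
      forall A : set M, <<s @open M >> A -> measurable (decode @^-1` A)].
Proof.
exists decode; split => //.
- move=> m; rewrite /polish_code; case: choice.unpickle => [[k n]|].
    have := open_ball (p n) (r k); rewrite ballEmdist; exact.
  by rewrite (_ : [set _ | _] = set0); [exact: open0|apply/seteqP; split].
- apply: smallest_sub; last exact: decode_open.
  split; first by rewrite /= preimage_set0; exact: measurable0.
  + by move=> A mA; rewrite /= setTD preimage_setC; exact: measurableC.
  + by move=> F mF; rewrite /= preimage_bigcup; exact: bigcupT_measurable.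
Qed.

End Polish.

(** A measurable left inverse records that the embedding [f] has a measurable
    range: this is the set where [f \o g] is the identity. *)
Lemma standard_borel_retract (R : realType) d (X : measurableType d) :
  standard_borel R X -> [set: X] !=set0 ->
  exists (f : X -> cantor) (g : cantor -> X),
  [/\ measurable_fun setT f, measurable_fun setT g & cancel f g].
Proof.
move=> [M [[D cD dD] cM] [h [h' hK h'K] mX]] [x0 _].
have [D0 DD0] : D !=set0.
  have [||y [_ Dy]] := dD setT; [by exists (h' x0)|exact: openT|by exists y].
have [p Dp] : exists p : nat -> M, D `<=` range p.
  have /countable_injP[i iI] := cD.
  exists (fun n => if pselect (exists2 x, D x & i x = n) is left e
                   then sval (cid2 e) else D0).
  move=> x Dx; exists (i x) => //.
  case: pselect => [e|]; last by case; exists x.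
  by case: cid2 => y Dy /= iyx; apply: iI => //; rewrite inE.
have dp : dense (range p).
  by move=> O O0 oO; have [y [Oy /Dp]] := dD O O0 oO; exists y.
have [dec [decK oc mdec]] := polish_retract cM dp.
exists (polish_code p \o h'), (h \o dec); split.
- apply: measurable_to_cantor => m.
  have mo : measurable [set x | polish_code p (h' x) m].
    apply/mX; rewrite (_ : _ @^-1` _ = [set y | polish_code p y m]).
      by apply: sub_sigma_algebra; exact: oc.
    by apply/seteqP; split=> y /=; rewrite hK.
  have := measurable_coloring_bool mo; congr measurable_coloring.
  by apply/funext => x; exact: asboolb.
- move=> _ A mA; rewrite setTI; exact: (mdec _ (proj1 (mX A) mA)).
- by move=> x /=; rewrite decK h'K.
Qed.

(** * Isomorphism of Borel partitions into uncountable sets *)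

Section FirstTrue.

(** A measurable map from the Cantor space to the natural numbers all of whose
    fibers are uncountable; a continuous one would have finite range, by
    compactness. *)
Definition first_true (c : nat -> bool) : nat :=
  if pselect (exists n, c n) is left e then ex_minn e else 0.

Let pad n (c : nat -> bool) : nat -> bool :=
  fun i => if (i < n)%N then false else (i == n) || c (i - n.+1)%N.

Lemma measurable_first_true : measurable_coloring (first_true : cantor -> nat).
Proof.
move=> n; rewrite (_ : _ @^-1` _ =
    [set c : cantor | c n /\ forall i, (i < n)%N -> ~~ c i] `|`
    ([set _ | n = 0%N] `&` [set c : cantor | forall i, ~~ c i])).
  apply: measurableU; apply: measurableI.
  - exact: cylinder_measurable.
  - apply: measurable_forall => i.
    exact: (measurable_coloring_preimage [set b | (i < n)%N -> ~~ b]
      (@measurable_coord i)).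
  - exact: measurable_prop.
  - apply: measurable_forall => i.
    exact: (measurable_coloring_preimage [set b | ~~ b] (@measurable_coord i)).
rewrite /first_true; apply/seteqP; split=> c /=.
- case: pselect => [e|ne].
    case: ex_minnP => m cm mmin <-; left; split => // i im.
    by apply/negP => /mmin; rewrite leqNgt im.
  by move=> <-; right; split => // i; apply/negP => ci; apply: ne; exists i.
- case=> [[cn nc]|[-> nc]]; case: pselect => //.
  + move=> e; case: ex_minnP => m cm mmin; apply/eqP; rewrite eqn_leq mmin//=.
    by rewrite leqNgt; apply/negP => /nc; rewrite cm.
  + by move=> []; exists n.
  + by move=> [i ci]; have := nc i; rewrite ci.
Qed.

Lemma first_true_fibers n : exists f : (nat -> bool) -> (nat -> bool),
  injective f /\ forall c, first_true (f c) = n.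
Proof.
exists (pad n); split=> [c c' cc'|c].
  have padE (k : nat -> bool) i : pad n k (n.+1 + i) = k i.
    rewrite /pad addSn ltnNge leqW ?leq_addr//= gtn_eqF ?ltnS ?leq_addr//.
    by rewrite subSS addKn.
  by apply/funext => i; rewrite -padE cc' padE.
rewrite /first_true; case: pselect => [e|[]]; last first.
  by exists n; rewrite /pad ltnn eqxx.
case: ex_minnP => m; rewrite {1}/pad; case: ltnP => // nm _ mmin.
apply/eqP; rewrite eqn_leq nm andbT; apply: mmin.
by rewrite /pad ltnn eqxx.
Qed.

End FirstTrue.

Section Retract.
Context d (X : measurableType d) (f : X -> cantor) (g : cantor -> X).
Hypotheses (mf : measurable_fun setT f) (mg : measurable_fun setT g)
  (fK : cancel f g).

Lemma measurable_equalizer d' (Y : measurableType d') (u v : Y -> X) :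
  measurable_fun setT u -> measurable_fun setT v ->
  measurable [set y | u y = v y].
Proof.
move=> mu mv.
rewrite (_ : [set _ | _] = [set y | forall n, f (u y) n = f (v y) n]).
  apply: measurable_forall => n.
  have mc w : measurable_fun setT w ->
      measurable_coloring (fun y : Y => f (w y) n).
    move=> mw.
    apply: (measurable_coloring_map (f := f \o w) _ (@measurable_coord n)).
    exact: measurableT_comp.
  exact: (measurable_coloring_preimage [set b : bool * bool | b.1 = b.2]
    (measurable_coloring_pair (mc _ mu) (mc _ mv))).
apply/seteqP; split=> y /= => [-> //|uv].
by apply: (can_inj fK); apply/funext.
Qed.

Lemma measurable_point (x : X) : measurable [set x].
Proof.
rewrite (_ : [set x] = [set y | id y = cst x y]).
  by apply: measurable_equalizer.
by [].
Qed.

(** The image of [A] is the set of the [y] with [s y] in [A] and [e (s y) = y]: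
    a measurable left inverse replaces the Lusin-Souslin theorem. *)
Lemma measurable_split_image (e s : X -> X) (A : set X) :
  measurable_fun setT e -> measurable_fun setT s -> cancel e s ->
  measurable A -> measurable (e @` A).
Proof.
move=> me ms eK mA.
rewrite (_ : _ @` _ = s @^-1` A `&` [set y | (e \o s) y = id y]).
  apply: measurableI; first exact: measurable_preimageT.
  by apply: measurable_equalizer => //; exact: measurableT_comp.
apply/seteqP; split=> [_ [x Ax <-]|y [Ay /= ey]]; first by rewrite /= eK.
by exists (s y).
Qed.

Lemma cantor_in_uncountable (B : set X) : measurable B -> ~ countable B ->
  exists (F : cantor -> X) (G : X -> cantor), [/\ measurable_fun setT F,
    measurable_fun setT G, cancel F G & forall c, B (F c)].
Proof.
move=> mB uB.
pose A : set cantor := [set c | B (g c) /\ f (g c) = c].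
have mA : measurable A.
  apply: measurableI; first exact: measurable_preimageT.
  rewrite (_ : (fun _ => _) = [set c : cantor | forall n, f (g c) n = c n]).
    apply: measurable_forall => n.
    have m1 : measurable_coloring (fun c : cantor => f (g c) n).
      apply: (measurable_coloring_map (f := f \o g) _ (@measurable_coord n)).
      exact: measurableT_comp.
    exact: (measurable_coloring_preimage [set b : bool * bool | b.1 = b.2]
      (measurable_coloring_pair m1 (@measurable_coord n))).
  by apply/seteqP; split=> c /= => [-> //|fg]; exact/funext.
have uA : ~ countable A.
  apply: contra_not uB => /(countable_preimage_inj (can_inj fK)).
  by apply: sub_countable_set => x Bx; rewrite /A /= fK.
have [F [G [mF mG FK AF]]] := cantor_embeds mA uA.
exists (g \o F), (G \o f); split.
- exact: measurableT_comp.
- exact: measurableT_comp.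
- by move=> c /=; have [_ ->] := AF c.
- by move=> c; have [] := AF c.
Qed.

Lemma embeds_in_uncountable (B : set X) : measurable B -> ~ countable B ->
  exists e s : X -> X, [/\ measurable_fun setT e, measurable_fun setT s,
    cancel e s & forall x, B (e x)].
Proof.
move=> mB uB; have [F [G [mF mG FK BF]]] := cantor_in_uncountable mB uB.
exists (F \o f), (g \o G); split.
- exact: measurableT_comp.
- exact: measurableT_comp.
- by move=> x /=; rewrite FK fK.
- by move=> x; exact: BF.
Qed.

(** The classical construction: [T] is [e] on the set [Z] generated from the
    complement of the range of [e'] by [e' \o e], and the inverse of [e'] off
    [Z]. The conclusion keeps track of which of the two maps is used at each
    point, from which invariance properties of [T] can be read. *)
Lemma borel_schroeder_bernstein (e s e' s' : X -> X) :
  measurable_fun setT e -> measurable_fun setT s -> cancel e s ->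
  measurable_fun setT e' -> measurable_fun setT s' -> cancel e' s' ->
  exists T : baut X, forall x, T x = e x \/ e' (T x) = x.
Proof.
move=> me ms eK me' ms' eK'.
pose Zn n := iter n (fun A => e' @` (e @` A)) (~` range e').
pose Z := \bigcup_n Zn n.
have mZ : measurable Z.
  apply: bigcupT_measurable; elim=> [|n IHn] /=.
    apply: measurableC; exact: (measurable_split_image me' ms' eK' measurableT).
  apply: (measurable_split_image me' ms' eK').
  exact: (measurable_split_image me ms eK).
have ZS x : Z (e' (e x)) <-> Z x.
  split=> [[[|n] _]|[n _ Zx]].
  - by case; exists (e x).
  - move=> [_ [z Zz <-]] /(can_inj eK')/(can_inj eK) <-.
    by exists n.
  - by exists n.+1 => //; exists (e x) => //; exists x.
have Ze' x : ~ Z x -> e' (s' x) = x.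
  move=> nZx; have [y _ <-] : range e' x.
    by apply: contrapT => nx; apply: nZx; exists 0%N.
  by rewrite eK'.
have Zs y : Z (e' y) -> exists2 z, Z z & y = e z.
  move=> [[|n] _]; first by case; exists y.
  by move=> [_ [z Zz <-]] /(can_inj eK') <-; exists z => //; exists n.
pose t x := if `[< Z x >] then e x else s' x.
pose t' y := if `[< (Z \o e') y >] then s y else e' y.
have tK : cancel t t'.
  move=> x; rewrite /t; case: asboolP => Zx; rewrite /t'; case: asboolP => /=.
  - by rewrite eK.
  - by move=> []; apply/ZS.
  - by rewrite Ze'.
  - by rewrite Ze'.
have t'K : cancel t' t.
  move=> y; rewrite /t'; case: asboolP => /= [/Zs[z Zz ->]|nZ]; rewrite /t.
  - by rewrite eK; case: asboolP.
  - by case: asboolP => //; rewrite eK'.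
have mt : measurable_fun setT t by exact: measurable_fun_cases.
have mt' : measurable_fun setT t'.
  apply: measurable_fun_cases => //; exact: measurable_preimageT.
exists (Baut tK t'K mt mt') => x /=; rewrite /t.
by case: asboolP => [|/Ze']; [left|right].
Qed.

(** The embeddings of the space into the classes of [b] glue, along [a], into one
    injection [e] with [b (e x) = a x], and symmetrically there is [e'] with
    [a (e' y) = b y]; both alternatives of the Schroeder-Bernstein construction
    then carry the color [a x] to the color [b (T x)]. *)
Lemma uncountable_colorings_conjugate (I : countType) (a b : X -> I) :
  measurable_coloring a -> measurable_coloring b ->
  (forall i, ~ countable (a @^-1` [set i])) ->
  (forall i, ~ countable (b @^-1` [set i])) ->
  exists T : baut X, forall x, b (T x) = a x.
Proof.
have emb (a' b' : X -> I) : measurable_coloring a' -> measurable_coloring b' ->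
    (forall i, ~ countable (b' @^-1` [set i])) ->
    exists e s : X -> X, [/\ measurable_fun setT e, measurable_fun setT s,
      cancel e s & forall x, b' (e x) = a' x].
  move=> ma mb ub.
  have /(_ _)/cid-/all_sig[e] i := embeds_in_uncountable (mb i) (ub i).
  move=> /(_ _)/cid-/all_sig[s es].
  exists (fun x => e (a' x) x), (fun y => s (b' y) y).
  have be x : b' (e (a' x) x) = a' x by have [_ _ _] := es (a' x); exact.
  split => //.
  - by apply: measurable_fun_glue => // i; have [] := es i.
  - by apply: measurable_fun_glue => // i; have [] := es i.
  - by move=> x; rewrite be; have [_ _ + _] := es (a' x); exact.
move=> ma mb ua ub.
have [e [s [me ms eK be]]] := emb a b ma mb ub.
have [e' [s' [me' ms' eK' ae]]] := emb b a mb ma ua.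
have [T TP] := borel_schroeder_bernstein me ms eK me' ms' eK'.
exists T => x; case: (TP x) => [-> //|e'T].
by rewrite -ae e'T.
Qed.

Lemma uncountable_coloring_exists (I : countType) (i0 : I) (B : set X) :
  measurable B -> ~ countable B ->
  exists2 a : X -> I, measurable_coloring a &
    forall i, ~ countable (B `&` a @^-1` [set i]).
Proof.
move=> mB uB; have [F [G [mF mG FK BF]]] := cantor_in_uncountable mB uB.
exists (fun x => odflt i0 (choice.unpickle (first_true (G x)))).
  apply: (measurable_coloring_comp (fun n => odflt i0 (choice.unpickle n))).
  exact: measurable_coloring_map measurable_first_true.
move=> i; have [h [hI hP]] := first_true_fibers (choice.pickle i).
apply: contra_not uB => cBi.
have FhfI : injective (F \o h \o f).
  by apply: inj_comp (can_inj fK); apply: inj_comp (can_inj FK) _.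
apply: sub_countable_set (countable_preimage_inj FhfI cBi) => x _ /=.
by split; [exact: BF|rewrite FK hP choice.pickleK].
Qed.

End Retract.

(** * Automorphisms with a clock *)

Local Open Scope group_scope.
Local Open Scope quotient_scope.

Section IntegerPowers.
Context d (X : measurableType d).
Implicit Types S T : baut X.

Definition zpow T (n : int) : baut X :=
  match n with Posz k => T ^+ k | Negz k => T ^- k.+1 end.

Lemma zpowS T n : zpow T (n + 1)%R = T * zpow T n.
Proof.
case: n => [k|[|k]].
- by rewrite -PoszD addn1 /= expgS.
- by rewrite /= expg1 mulgV.
- rewrite (_ : (Negz k.+1 + 1)%R = Negz k); last first.
    by rewrite !NegzE -addn1 PoszD opprD addrNK.
  by rewrite /= [T ^+ k.+2]expgSr invgM mulVKg.
Qed.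

Lemma zpowD T m n : zpow T (m + n)%R = zpow T m * zpow T n.
Proof.
elim/int_ind: m => [|k IHk|k IHk].
- by rewrite add0r mul1g.
- by rewrite -addn1 PoszD -addrA (addrC 1%R) addrA !zpowS IHk mulgA.
- apply: (@mulgI _ T); rewrite mulgA -!zpowS.
  rewrite -addrA (addrC n) addrA -addn1 PoszD opprD addrNK; exact: IHk.
Qed.

Lemma baut_orbitE T x : baut_orbit T x = range (fun n => zpow T n x).
Proof.
apply/seteqP; split=> [_ [[n _ <-]|[[|n] _ <-]]|_ [[n|n] _ <-]].
- by exists (Posz n).
- by exists 0%R.
- by exists (Negz n).
- by left; exists n.
- by right; exists n.+1.
Qed.

Lemma expg_fixed T k x : T x = x -> (T ^+ k) x = x.
Proof. by move=> Tx; elim: k => // k IHk; rewrite expgS bautME IHk. Qed.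

Lemma aperiodic_zpow_inj T x : aperiodic T -> injective (fun n => zpow T n x).
Proof.
move=> aT; have periodic m : (T ^+ m.+1) x <> x.
  move=> Tx; apply: (aT x).
  have Tred n : (T ^+ n) x = (T ^+ (n %% m.+1)) x.
    rewrite {1}(divn_eq n m.+1) addnC mulnC expgnDr expgnA bautME.
    by rewrite (@expg_fixed (T ^+ m.+1) _ x).
  apply: (@sub_finite_set _ _ ((fun i => (T ^+ i) x) @` `I_m.+1)); last first.
    exact/finite_image/finite_II.
  move=> _ [[n _ <-]|[n _ <-]].
    by rewrite Tred; exists (n %% m.+1)%N => //=; rewrite ltn_mod.
  suff -> : (T ^- n) x = (T ^+ (n * m)) x.
    by rewrite Tred; exists ((n * m) %% m.+1)%N => //=; rewrite ltn_mod.
  apply: (can_inj (bautVK (T ^+ n))).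
  rewrite bautKV -bautME -expgnDr -mulnS mulnC expgnA.
  by rewrite (@expg_fixed (T ^+ m.+1) _ x).
have lt_neq m n : (m < n)%R -> zpow T m x <> zpow T n x.
  move=> mn e; have [k kE] : exists k, (n - m)%R = Posz k.+1.
    have : (0 < n - m)%R by rewrite Num.Theory.subr_gt0.
    by case: (n - m)%R => [[|k]|k] // _; exists k.
  apply: (periodic k); rewrite -[T ^+ k.+1]/(zpow T (Posz k.+1)) -kE.
  apply: (can_inj (bautVK (zpow T m))).
  by rewrite -bautME -zpowD addrC subrK.
move=> m n e; apply/eqP; case: (Num.Theory.ltrgtP m n) => // mn.
- by have := lt_neq _ _ mn e.
- by have := lt_neq _ _ mn (esym e).
Qed.

End IntegerPowers.

Section Clocks.
Context d (X : measurableType d).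
Implicit Types S T : baut X.

(** A clock exhibits [S] as a shift: the space is the product of the zero level
    of [N] with the integers, and [S] translates the second factor. *)
Definition clock S (N : X -> int) :=
  measurable_coloring N /\ forall x, N (S x) = (N x + 1)%R.

Lemma measurable_zpow T n : measurable_fun setT (zpow T n).
Proof. exact: measurable_baut. Qed.

(** The time of [x] is the opposite of the exponent that brings [x] to the
    transversal; aperiodicity makes this exponent unique. *)
Lemma smooth_clock S : aperiodic S -> smooth S -> exists N, clock S N.
Proof.
move=> aS [A mA SA].
have /(_ _)/cid-/all_sig[k kA] : forall x, exists k, A (zpow S k x).
  move=> x; have [y [[Ay]]] := SA x; rewrite baut_orbitE => -[k _ ky] _.
  by exists k; rewrite ky.
have kU x m n : A (zpow S m x) -> A (zpow S n x) -> m = n.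
  move=> Am An; have [y [_ yU]] := SA x.
  have yE l : A (zpow S l x) -> y = zpow S l x.
    by move=> Al; apply: yU; rewrite baut_orbitE; split => //; exists l.
  by apply: (aperiodic_zpow_inj aS (x := x)); rewrite /= -(yE m Am) -(yE n An).
exists (fun x => (- k x)%R); split=> [n|x].
- rewrite (_ : _ @^-1` _ = zpow S (- n)%R @^-1` A).
    exact: measurable_preimageT (measurable_zpow _ _) mA.
  apply/seteqP; split=> x /= => [<-|Ax]; first by rewrite opprK.
  by rewrite (kU _ _ _ (kA x) Ax) opprK.
- suff -> : k x = (k (S x) + 1)%R by rewrite opprD addrNK.
  apply: (kU x); first exact: kA.
  by rewrite zpowD bautME; exact: kA.
Qed.

Lemma clock_zpow S N n x : clock S N -> N (zpow S n x) = (N x + n)%R.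
Proof.
move=> [_ NS]; elim/int_ind: n => [|n IHn|n IHn]; first by rewrite addr0.
- by rewrite -addn1 PoszD zpowS bautME NS IHn addrA.
- apply: (addIr 1%R); rewrite -NS -bautME -zpowS.
  by rewrite -addn1 PoszD opprD addrNK IHn addrA addrNK.
Qed.

(** Each orbit reads the bi-infinite walk that extends, by [next] and [prev], the
    edge chosen by [start] at the point where the clock of the orbit is zero. *)
Lemma clock_walk S N (E : countType) (V : Type) (src tgt : E -> V)
    (next prev : E -> E) (start : X -> E) :
  (forall e, src (next e) = tgt e) -> (forall e, tgt (prev e) = src e) ->
  clock S N -> measurable_coloring start ->
  exists2 l : X -> E, measurable_coloring l &
    (forall x, src (l (S x)) = tgt (l x)) /\
    (forall x, N x = 0%R -> l x = start x).
Proof.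
move=> nextP prevP cN ms.
pose w (e : E) (n : int) : E :=
  match n with Posz k => iter k next e | Negz k => iter k.+1 prev e end.
have wS e n : src (w e (n + 1)%R) = tgt (w e n).
  case: n => [k|[|k]]; first by rewrite -PoszD addn1 /= nextP.
    by rewrite /= prevP.
  rewrite (_ : (Negz k.+1 + 1)%R = Negz k); first by rewrite /= prevP.
  by rewrite !NegzE -addn1 PoszD opprD addrNK.
exists (fun x => w (start (zpow S (- N x)%R x)) (N x)).
  apply: (measurable_coloring_glue
    (b := fun n x => w (start (zpow S (- n)%R x)) n)); first exact: cN.1.
  move=> n; apply: (measurable_coloring_comp (w^~ n)).
  exact: measurable_coloring_map (measurable_zpow _ _) ms.
split=> x.
- rewrite cN.2 wS opprD [(- N x - 1)%R]addrC; congr (tgt (w (start _) _)).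
  rewrite addrC -[S x]/((zpow S 1) x) -bautME -zpowD; congr (zpow _ _ _).
  by rewrite addrNK.
- by move=> ->; rewrite oppr0.
Qed.

End Clocks.

(** * Approximating an automorphism by conjugates of a shift *)

Lemma uncountable_color (T : Type) (I : countType) (a : T -> I) (A : set T) :
  ~ countable A -> exists i, ~ countable (A `&` a @^-1` [set i]).
Proof.
move=> uA; apply/existsNP => ca; apply: uA.
apply: (@sub_countable_set _ _ (\bigcup_i (A `&` a @^-1` [set i]))).
  by move=> x Ax; exists (a x).
by apply: bigcup_countable.
Qed.

Lemma uncountable_nonempty (T : Type) (A : set T) : ~ countable A -> A !=set0.
Proof. by move=> uA; apply/set0P/negP => /eqP A0; apply: uA; rewrite A0. Qed.

Section Density.
Context d (X : measurableType d) (f : X -> cantor) (g : cantor -> X).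
Hypotheses (mf : measurable_fun setT f) (mg : measurable_fun setT g)
  (fK : cancel f g) (uX : ~ countable [set: X]).
Implicit Types (S T W P Q : baut X).

Lemma baut_inj T : injective T.
Proof. exact: can_inj (bautVK T). Qed.

Lemma countable_baut_preimage T (A : set X) :
  countable A -> countable (T @^-1` A).
Proof. exact/countable_preimage_inj/baut_inj. Qed.

Lemma countable_invariant_hull P (Z1 : set X) : countable Z1 ->
  exists Z, [/\ countable Z, Z1 `<=` Z & forall x, Z (P x) <-> Z x].
Proof.
move=> cZ1; exists (\bigcup_n (zpow P n @^-1` Z1)); split.
- by apply: bigcup_countable => // n _; exact: countable_baut_preimage.
- by move=> x Zx; exists 0%R.
- move=> x; split=> [[n _ Zn]|[n _ Zn]].
  + by exists (n + 1)%R => //; rewrite /= zpowD bautME.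
  + exists (n - 1)%R => //=.
    by rewrite -[P x]/(zpow P 1 x) -bautME -zpowD subrK.
Qed.

(** If [P] preserves the coloring [k] off a countable set, let [C] be [P] on a
    countable [P]-invariant set that contains the exceptions, and the identity
    elsewhere. Then [C] moves the colors exactly as [P] does, even when some
    color classes are countable. *)
Lemma countable_correction (V : Type) (k : X -> V) P :
  countable [set z | k z <> k (P^-1 z)] ->
  exists2 C, ctbl C & forall z, k (C^-1 z) = k (P^-1 z).
Proof.
move=> /(countable_invariant_hull P)[Z [cZ Z1Z PZ]].
have mZ : measurable Z.
  by apply: countable_measurable cZ; exact: (measurable_point mf fK).
pose c z := if `[< Z z >] then P z else z.
pose c' z := if `[< Z z >] then P^-1 z else z.
have P'Z z : Z (P^-1 z) <-> Z z by rewrite -PZ bautKV.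
have cK : cancel c c'.
  move=> z; rewrite /c; case: asboolP => Zz; rewrite /c'; case: asboolP => //.
    by rewrite bautVK.
  by case; apply/PZ.
have c'K : cancel c' c.
  move=> z; rewrite /c'; case: asboolP => Zz; rewrite /c; case: asboolP => //.
    by rewrite bautKV.
  by case; apply/P'Z.
have mc : measurable_fun setT c.
  by apply: measurable_fun_cases => //; exact: measurable_baut.
have mc' : measurable_fun setT c'.
  by apply: measurable_fun_cases => //; exact: (measurable_baut P^-1).
exists (Baut cK c'K mc mc').
  apply: sub_countable_set cZ => z /=; apply: contra_notP => nZz.
  by rewrite /c; case: asboolP.
move=> z; change (k (c' z) = k (P^-1 z)); rewrite /c'; case: asboolP => // nZz.
by apply: contrapT => kz; apply: nZz; exact: Z1Z.
Qed.

(** The heart of the proof: modulo a countably supported correction, some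
    conjugate of a shift transports the coloring [k] as [T] does. *)
Lemma clock_conjugate_coloring S N T (V : countType) (k : X -> V) :
  clock S N -> measurable_coloring k ->
  exists R C, ctbl C /\ forall y, k ((R^-1 * S * R * C)^-1 y) = k (T^-1 y).
Proof.
move=> cN mk.
pose c x := (k (T^-1 x), k x).
have mc : measurable_coloring c.
  apply: measurable_coloring_pair (mk).
  exact: measurable_coloring_map (measurable_baut T^-1) mk.
pose edge := {e : V * V | `[< ~ countable (c @^-1` [set e]) >]}.
have edgeP (e : edge) : ~ countable (c @^-1` [set val e]).
  by apply/asboolP/(valP e).
have new_edge (A : set X) : ~ countable A ->
    exists2 e : edge, True & exists2 x, A x & c x = val e.
  move=> /(uncountable_color c)[e ue].
  have ee : `[< ~ countable (c @^-1` [set e]) >].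
    by apply/asboolP; apply: contra_not ue; apply: sub_countable_set => x [].
  have [x [Ax cx]] := uncountable_nonempty ue.
  by exists (Sub e ee) => //; exists x.
have [e0 _ _] := new_edge _ uX.
pose src (e : edge) := (val e).1; pose tgt (e : edge) := (val e).2.
(* The points that [T] sends to the class of [e] are uncountably many, so
   uncountably many of them lie on one edge, which precedes [e]. *)
have /(_ _)/cid-/all_sig[prev prevP] : forall e, exists e', tgt e' = src e.
  move=> e; have [|e' _ [x]] := new_edge (T @^-1` (c @^-1` [set val e])).
    apply: contra_not (edgeP e) => /(@countable_baut_preimage T^-1).
    by apply: sub_countable_set => x; rewrite /preimage /mkset bautKV.
  move=> cTx cx; exists e'; apply: etrans (esym (congr1 snd cx)) _.
  exact: etrans (congr1 k (esym (bautVK T x))) (congr1 fst cTx).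
have /(_ _)/cid-/all_sig[next nextP] : forall e, exists e', src e' = tgt e.
  move=> e; have [|e' _ [x]] := new_edge (T^-1%g @^-1` (c @^-1` [set val e])).
    apply: contra_not (edgeP e) => /(@countable_baut_preimage T).
    by apply: sub_countable_set => x; rewrite /preimage /mkset bautVK.
  move=> cTx cx; exists e'.
  exact: etrans (esym (congr1 fst cx)) (congr1 snd cTx).
have mN0 : measurable (N @^-1` [set 0%R]) by exact: cN.1.
have uN0 : ~ countable (N @^-1` [set 0%R]).
  apply: contra_not uX => cN0.
  apply: (@sub_countable_set _ _
    (\bigcup_n (zpow S n @^-1` (N @^-1` [set 0%R])))).
    by move=> x _; exists (- N x)%R => //=; rewrite (clock_zpow _ _ cN) subrr.
  by apply: bigcup_countable => // n _; exact: countable_baut_preimage.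
have [start mstart ustart] := uncountable_coloring_exists mf mg fK e0 mN0 uN0.
have [l ml [lS l0]] := clock_walk nextP prevP cN mstart.
have ul e : ~ countable (l @^-1` [set e]).
  apply: contra_not (ustart e); apply: sub_countable_set => x [/= Nx sx].
  by rewrite l0.
(* The pairs of colors that are not edges are relabelled arbitrarily: they
   occur on the countable set [bad] only. *)
pose idx x := insubd e0 (c x).
have midx : measurable_coloring idx by exact: measurable_coloring_comp mc.
have uidx e : ~ countable (idx @^-1` [set e]).
  apply: contra_not (edgeP e); apply: sub_countable_set => x /= cx.
  by rewrite /idx cx valKd.
have [R lR] := uncountable_colorings_conjugate mf mg fK midx ml uidx ul.
pose bad := [set x | c x <> val (idx x)].
have cbad : countable bad.
  apply: (@sub_countable_set _ _ (\bigcup_(e in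
      [set e | countable (c @^-1` [set e])]) (c @^-1` [set e]))).
    move=> x bx; exists (c x) => //=; apply: contrapT => ux; apply: bx.
    by rewrite /idx insubdK //; exact/asboolP.
  exact: bigcup_countable.
pose Q := R^-1 * S * R.
have [|C cC CP] := @countable_correction _ k (Q^-1 * T).
  apply: (@sub_countable_set _ _ (bad `|` Q @^-1` bad)); last first.
    by apply: countable_setU => //; exact: countable_baut_preimage.
  have good x : ~ bad x -> c x = val (idx x) by move=> ?; exact: contrapT.
  move=> z kz; have [bz|/good cz] := pselect (bad z); [by left|right].
  apply: contrapT => /good cQz; apply: kz; rewrite invgM invgK bautME.
  have -> : k (T^-1 (Q z)) = src (idx (Q z)) by rewrite /src -cQz.
  have -> : k z = tgt (idx z) by rewrite /tgt -cz.
  rewrite -!lR -lS; congr (src (l _)).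
  by rewrite /Q !bautME bautKV.
exists R, C; split => // y.
by rewrite -/Q invgM bautME CP invgM invgK bautME bautKV.
Qed.

(** The finite family [Fs] enters the weak topology through the partition that it
    generates, whose classes are the fibers of this coloring. *)
Definition trace (Fs : seq (set X)) (x : X) : seq bool :=
  [seq `[< F x >] | F : set X <- Fs].

Lemma measurable_trace Fs : (forall F, F \in Fs -> measurable F) ->
  measurable_coloring (trace Fs).
Proof.
elim: Fs => [_ w|F Fs IHFs mFs]; first exact: (@measurable_prop _ X ([::] = w)).
have mF : measurable F by apply: mFs; rewrite mem_head.
have mt : measurable_coloring (trace Fs).
  by apply: IHFs => G GFs; apply: mFs; rewrite in_cons GFs orbT.
exact: (measurable_coloring_comp (fun p : bool * seq bool => p.1 :: p.2)
  (measurable_coloring_pair (measurable_coloring_bool mF) mt)).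
Qed.

Lemma trace_weak_nbhd (Fs : {fset (set X)}) T W :
  (forall y : X, trace Fs (W^-1 y) = trace Fs (T^-1 y)) -> weak_nbhd T Fs W.
Proof.
move=> tUT F FFs.
have FE y : F (W^-1 y) <-> F (T^-1 y).
  have /eq_in_map/(_ F FFs) := tUT y.
  by move=> e; split=> /asboolP Fy; apply/asboolP; [rewrite -e|rewrite e].
have image_baut P : P @` F = [set y | F (P^-1 y)].
  apply/seteqP; split=> [_ [x Fx <-]|y Fy]; first by rewrite /mkset bautVK.
  by exists (P^-1 y) => //; rewrite bautKV.
by rewrite !image_baut; apply/seteqP; split=> y /FE.
Qed.

Lemma clock_conjugates_dense S N : clock S N ->
  closure [set T^-1 * \pi_(aut0 X) S * T | T in [set: aut0 X]] = [set: aut0 X].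
Proof.
move=> cN; rewrite -subTset => t _; elim/aut0_ind: t => T B.
move=> /aut0_pi_continuous/weak_nbhsE[Fs mFs sB].
have [R [C [cC RC]]] := clock_conjugate_coloring T cN (measurable_trace mFs).
exists (\pi_(aut0 X) (R^-1 * S * R * C)); split; last first.
  exact/sB/trace_weak_nbhd.
exists (\pi_(aut0 X) R) => //.
rewrite -piV -(piM R^-1 S) -(piM (R^-1 * S) R); apply/aut0P.
by rewrite mulKg.
Qed.

(** An automorphism that increases by one an integer coloring with uncountable
    classes conjugates this coloring with its translate. *)
Lemma clock_exists : exists S N, clock S N.
Proof.
have [a ma uTa] :=
  uncountable_coloring_exists mf mg fK (0 : int)%R measurableT uX.
have ua n : ~ countable (a @^-1` [set n]) by have := uTa n; rewrite setTI.
have ma1 : measurable_coloring (fun x => (a x + 1)%R).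
  exact: (measurable_coloring_comp (fun n : int => (n + 1)%R) ma).
have ua1 n : ~ countable ((fun x => (a x + 1)%R) @^-1` [set n]).
  apply: contra_not (ua (n - 1)%R); apply: sub_countable_set => x /= ->.
  by rewrite subrK.
have [S aS] := uncountable_colorings_conjugate mf mg fK ma1 ma ua1 ua.
by exists S, a.
Qed.

(** One dense conjugacy class suffices: conjugates of the same class in [U] and in
    [V] are conjugate to each other. *)
Lemma aut0_rokhlin : conj_topologically_transitive (aut0 X).
Proof.
have [S [N /clock_conjugates_dense dS]] := clock_exists.
have meets (U : set (aut0 X)) : open U -> U !=set0 ->
    exists h, U (h^-1 * \pi_(aut0 X) S * h).
  move=> oU [u Uu]; have : [set: aut0 X] u by [].
  rewrite -dS => /(_ U (open_nbhs_nbhs (conj oU Uu)))[_ [[h _ <-] Uh]].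
  by exists h.
move=> U V oU U0 oV V0.
have [h Uh] := meets U oU U0; have [k Vk] := meets V oV V0.
exists (h^-1 * k), (k^-1 * \pi_(aut0 X) S * k); split => //.
exists (h^-1 * \pi_(aut0 X) S * h) => //.
by rewrite invgM invgK !mulgA !mulgK.
Qed.

End Density.

Theorem corollary3p10 (R : realType) (d : measure_display)
    (X : measurableType d)
    (hX : standard_borel R X) (uncountableX : ~ countable [set: X]) :
  conj_topologically_transitive (aut0 X) /\
  (forall S : baut X, aperiodic S -> smooth S ->
    closure [set T^-1 * \pi_(aut0 X) S * T | T in [set: aut0 X]] =
    [set: aut0 X]).
Proof.
have [f [g [mf mg fK]]] :=
  standard_borel_retract hX (uncountable_nonempty uncountableX).
split; first exact: (aut0_rokhlin mf mg fK uncountableX).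
move=> S aS sS; have [N cN] := smooth_clock aS sS.
exact: (clock_conjugates_dense mf mg fK uncountableX cN).
Qed.
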